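(* Let $n,q$ be positive integers with $q<n$, and let $A\in\mathbb{R}^{n\times n}$ and $C\in\mathbb{R}^{q\times n}$ be such that the pair $(A,C)$ is observable. Define $$\widetilde{A}=\begin{pmatrix} A & 0\\ 0 & I_q\end{pmatrix}\in\mathbb{R}^{(n+q)\times(n+q)},\qquad \widetilde{C}=\begin{pmatrix} C & I_q\end{pmatrix}\in\mathbb{R}^{q\times(n+q)},$$ where $I_q$ is the $q\times q$ identity matrix. If $1$ is an eigenvalue of $A$, then the pair $(\widetilde{A},\widetilde{C})$ is not observable.
   Context: For $F\in\mathbb{R}^{m\times m}$ and $H\in\mathbb{R}^{p\times m}$, the pair $(F,H)$ is called observable if the discrete-time linear system $z(k+1)=Fz(k)$, $y(k)=Hz(k)$, $k=0,1,2,\dots$, is observable, i.e., the observability matrix obtained by stacking $H, HF, \dots, HF^{m-1}$ vertically has rank $m$ (full column rank). The pair $(\widetilde{A},\widetilde{C})$ describes the augmented system with state $z(k)=(x(k)^\top,a(k)^\top)^\top$, where $x(k+1)=Ax(k)$, $y(k)=Cx(k)+a(k)$, and $a(k)\in\mathbb{R}^q$ is an unknown vector (sensor attack) that is constant in time. *)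

(* Defs.v *)
From HB Require Import structures.
From mathcomp Require Import all_boot all_order all_algebra.
From mathcomp Require Import reals.

Set Implicit Arguments.
Unset Strict Implicit.
Unset Printing Implicit Defensive.

Import GRing.Theory Num.Theory.
Local Open Scope ring_scope.

(* Kalman matrix of z(k+1) = F z(k), y(k) = H z(k), with column states z(k);
   the powers use the ring structure that 'M[R]_m has for every m. *)
Definition observability_mx (R : realType) (m p : nat)
    (F : 'M[R]_m) (H : 'M[R]_(p, m)) : 'M[R]_(\sum_(i < m) p, m) :=
  \mxcol_(i < m) (H *m F ^+ i).

Definition observable (R : realType) (m p : nat)
    (F : 'M[R]_m) (H : 'M[R]_(p, m)) : Prop :=
  \rank (observability_mx F H) = m.

(* The system x(k+1) = A x(k), y(k) = C x(k) + a(k), with a(k) constant in k,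
   in the state z(k) = (x(k), a(k)). *)
Definition augmented_state_mx (R : realType) (n q : nat) (A : 'M[R]_n) :
    'M[R]_(n + q) :=
  block_mx A 0 0 1%:M.

Definition augmented_output_mx (R : realType) (n q : nat) (C : 'M[R]_(q, n)) :
    'M[R]_(q, n + q) :=
  row_mx C 1%:M.

(* Main.v *)
(* If [A x = x] with [x != 0], then the state [(x, - C x)] is nonzero, is fixed
   by the augmented dynamics and has output [C x - C x = 0]: the constant attack
   hides the mode of [A] at 1. *)
Require Import Defs.
From HB Require Import structures.
From mathcomp Require Import all_boot all_order all_algebra.
From mathcomp Require Import reals.

Set Implicit Arguments.
Unset Strict Implicit.
Unset Printing Implicit Defensive.

Import GRing.Theory Num.Theory.
Local Open Scope ring_scope.

(** An observable pair admits no nonzero state that is fixed by the dynamics and has zero output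
    ([observable_fixed_eq0]); a right eigenvector of [A] at 1 yields such a state. *)

(* MathComp's [eigenvalue] is defined with row (left) eigenvectors. *)
Lemma eigenvalue_right_eigenvector (F : fieldType) (m : nat) (A : 'M[F]_m) (a : F) :
  eigenvalue A a -> exists2 x : 'cV[F]_m, A *m x = a *: x & x != 0.
Proof.
(* A square matrix is singular iff its transpose is. *)
rewrite /eigenvalue /eigenspace kermx_eq0 row_free_unit -unitmx_tr.
rewrite -row_free_unit -kermx_eq0 => /rowV0Pn[v /sub_kermxP vK v_neq0].
exists v^T; last by rewrite trmx_eq0.
apply/eqP; rewrite -mul_scalar_mx -subr_eq0 -mulmxBl.
by rewrite -(inj_eq (@trmx_inj _ _ _)) trmx_mul trmxK vK trmx0.
Qed.

Lemma mulmx_expr_fixed (R : pzRingType) (m p : nat) (F : 'M[R]_m)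
    (z : 'M[R]_(m, p)) (k : nat) :
  F *m z = z -> F ^+ k *m z = z.
Proof.
move=> Fz; elim: k => [|k IHk]; first by rewrite expr0 mul1mx.
by rewrite exprSr -[LHS]mulmxA Fz.
Qed.

(** Each block gives [H *m F ^+ i *m z = H *m z = 0], and full column rank provides a left inverse
    [L] of the observability matrix. *)
Lemma observable_fixed_eq0 (R : realType) (m p : nat) (F : 'M[R]_m)
    (H : 'M[R]_(p, m)) (z : 'cV[R]_m) :
  observable F H -> F *m z = z -> H *m z = 0 -> z = 0.
Proof.
move=> /eqP /row_fullP[L LO] Fz Hz.
rewrite -[z]mul1mx -LO -mulmxA /observability_mx mxcol_mul.
under eq_mxcol do rewrite -mulmxA mulmx_expr_fixed // Hz.
by rewrite mxcol0 mulmx0.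
Qed.

Theorem proposition1 (R : realType) (n q : nat)
    (n_gt0 : (0 < n)%N) (q_gt0 : (0 < q)%N) (q_lt_n : (q < n)%N)
    (A : 'M[R]_n) (C : 'M[R]_(q, n))
    (obsAC : observable A C)
    (eigA1 : eigenvalue A 1) :
  ~ observable (augmented_state_mx q A) (augmented_output_mx C).
Proof.
have [x Ax /eqP x_neq0] := eigenvalue_right_eigenvector eigA1; rewrite scale1r in Ax.
move=> obs; apply: x_neq0.
have: col_mx x (- (C *m x)) = 0.
  apply: (observable_fixed_eq0 obs).
    by rewrite mul_block_col Ax !mul0mx mul1mx addr0 add0r.
  by rewrite mul_row_col mul1mx subrr.
by move=> /(congr1 usubmx); rewrite col_mxKu linear0.
Qed.
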